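(* There exists a universal constant $c>0$ with the following property. Let $(\mathcal X,d)$ be a metric space, $F\subset C(\mathcal X,\mathcal X)$, $H\subset C(\mathcal X)$, $k\ge0$, $S=(X_1,\dots,X_n)$ a sample in $\mathcal X$, $B_k:=B(k,F)$ and $\mathcal H_k:=H\circ B_k$. Suppose there exist constants $\kappa,R_{\rm out}>0$ and, for each $f\in B_k$, a readout $h_f\in H$ such that the map $\Psi_k:B_k\to\mathcal H_k$, $\Psi_k(f):=h_f\circ f$, satisfies $$\|\Psi_k(f)-\Psi_k(g)\|_S\ge\kappa\,d_S(f,g)\quad(f,g\in B_k),\qquad \|\Psi_k(f)\|_{S,\infty}\le R_{\rm out}\quad(f\in B_k).$$ Then $$\hat{\mathfrak R}_S(\mathcal H_k)\ge c\,\sup_{\varepsilon>0}\min\Big\{\kappa\varepsilon\sqrt{\frac{\log M(B_k,d_S,2\varepsilon)}{n}},\ \frac{\kappa^2\varepsilon^2}{R_{\rm out}}\Big\}.$$ The same conclusion holds with covering numbers $N(B_k,d_S,\cdot)$ in place of packing numbers $M(B_k,d_S,\cdot)$, up to changing the constant $c$ and the scale factor $2$ to other absolute positive constants.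
   Context: $B(k,F)$ is the set of all compositions $f_m\circ\cdots\circ f_1$ with $0\le m\le k$, $f_i\in F$ (including the identity), and $H\circ B_k=\{h\circ f:h\in H,f\in B_k\}$. $d_S(f,g):=\big(\frac1n\sum_{i=1}^n d(f(X_i),g(X_i))^2\big)^{1/2}$ for self-maps of $\mathcal X$. For real functions, $\|u\|_S:=\big(\frac1n\sum_i|u(X_i)|^2\big)^{1/2}$ and $\|u\|_{S,\infty}:=\max_{i}|u(X_i)|$. $M(A,\rho,\varepsilon)$ is the packing number, the maximal cardinality of a subset of $A$ with pairwise $\rho$-distances $\ge\varepsilon$; $N(A,\rho,\varepsilon)$ is the covering number, the least number of $\rho$-balls of radius $\varepsilon$ covering $A$. $\hat{\mathfrak R}_S(G):=\mathbb E_\sigma\big[\sup_{g\in G}\frac1n\sum_{i=1}^n\sigma_i g(X_i)\big]$ with i.i.d. Rademacher signs $\sigma_i$. *)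

(* Defs.v *)
From mathcomp Require Import all_boot all_order all_algebra.
From mathcomp Require Import all_classical all_reals all_analysis.

Set Implicit Arguments.
Unset Strict Implicit.
Unset Printing Implicit Defensive.

Import Order.TTheory GRing.Theory Num.Theory.
Import numFieldNormedType.Exports.

Local Open Scope classical_set_scope.
Local Open Scope ring_scope.

(* [:: f_m; ...; f_1] is folded to f_m \o ... \o f_1; the empty word gives the
   identity. *)
Definition compositions (X : choiceType) (k : nat) (F : set (X -> X)) :
    set (X -> X) :=
  [set g | exists s : seq (X -> X),
     [/\ (size s <= k)%N, (forall f, f \in s -> F f)
       & g = foldr (fun f h => f \o h) idfun s]].

Definition comp_class (X Y Z : Type) (H : set (Y -> Z)) (B : set (X -> Y)) :
    set (X -> Z) :=
  [set u | exists h f, [/\ H h, B f & u = h \o f]].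

Section Sample.
Context {R : realType} {n : nat}.

Definition dist_sample {X : metricType R} (S : 'I_n -> X) (f g : X -> X) : R :=
  Num.sqrt (n%:R^-1 * \sum_(i < n) mdist (f (S i)) (g (S i)) ^+ 2).

Definition norm2_sample {X : Type} (S : 'I_n -> X) (u : X -> R) : R :=
  Num.sqrt (n%:R^-1 * \sum_(i < n) `|u (S i)| ^+ 2).

Definition normsup_sample {X : Type} (S : 'I_n -> X) (u : X -> R) : R :=
  \big[Num.max/0]_(i < n) `|u (S i)|.

Local Open Scope ereal_scope.

(* The law of n i.i.d. Rademacher signs is the uniform law on {-1, 1}^n; a sign
   vector is encoded by s : {ffun 'I_n -> bool}, its i-th sign being
   (-1) ^+ s i.  The value is extended real since the suprema may be infinite. *)
Definition rademacher {X : Type} (S : 'I_n -> X) (G : set (X -> R)) : \bar R :=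
  ((2 ^+ n)^-1)%:E * \sum_(s : {ffun 'I_n -> bool})
    ereal_sup [set (n%:R^-1 * \sum_(i < n) (-1) ^+ s i * g (S i))%R%:E
              | g in G].

End Sample.

Section PackingCovering.
Context {R : realType} {T : choiceType}.
Local Open Scope ereal_scope.

(* counting P is the cardinality of P, +oo when P is infinite. *)
Definition packing_number (A : set T) (rho : T -> T -> R) (eps : R) : \bar R :=
  ereal_sup [set counting P | P in
    [set P : set T | P `<=` A /\
       forall x y, P x -> P y -> x <> y -> (eps <= rho x y)%R]].

(* Open balls of the pseudometric space (A, rho), hence with centres in A;
   this is the largest of the usual variants (closed balls, or centres outside
   A, can only decrease it). *)
Definition covering_number (A : set T) (rho : T -> T -> R) (eps : R) : \bar R :=
  ereal_inf [set counting P | P in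
    [set P : set T | P `<=` A /\
       A `<=` \bigcup_(x in P) [set y | (rho x y < eps)%R]]].

End PackingCovering.

(* Main.v *)
(* The packing bound is Sudakov's minoration for a finite Bernoulli process
   Z_j = sum_i s_i t_(j, i), j in J, with |t_(j, i)| <= b and points
   t_j at squared distance at least A.  Let p be the Gibbs measure on J with
   weights exp (lam Z_j), where lam b <= 1.  The expected maximum dominates the
   expected Gibbs mean of Z.  Flipping one sign at a time computes the latter as
   a sum of increments of Gibbs means, which are comparable to lam times Gibbs
   variances because lam b <= 1; separation bounds it below by
   c lam A E (1 - max_j p_j).  On the other hand - ln (max_j p_j) has expectation
   at least ln |J| - lam E (max_j Z_j) and is at most ln |J|, so either
   lam E (max_j Z_j) >= (ln |J|) / 2 or E (1 - max_j p_j) >= 1/6.  Choosing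
   lam = min (sqrt (ln |J| / A), 1 / b) gives the bound in both cases.

   A maximal packing is a covering at the same scale, which yields the
   covering-number version with a = 2 and the same constant. *)
Require Import Defs.
From mathcomp Require Import all_boot all_order all_algebra finmap.
From mathcomp Require Import all_classical all_reals all_analysis.
From mathcomp Require Import ring lra.

Set Implicit Arguments.
Unset Strict Implicit.
Unset Printing Implicit Defensive.

Import Order.TTheory GRing.Theory Num.Theory.
Import numFieldNormedType.Exports.

Local Open Scope classical_set_scope.
Local Open Scope ring_scope.

(** * Change of a Gibbs mean under an exponential tilt *)

Section GibbsMeans.
Context {R : realType} {J : finType}.

(** On [-1, 1] the function exp (-2 z) decreases with slope at least 2 exp (-2) in absolute
    value. *)
Lemma expR_increment_ge (y z : R) : -1 <= y <= 1 -> -1 <= z <= 1 ->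
  2 * expR (-2) * (y - z) ^+ 2 <=
  (y - z) * (expR (- 2 * z) - expR (- 2 * y)).
Proof.
wlog zy : y z / z <= y => [hwlog yb zb|].
  have [/hwlog->//|/ltW yz] := leP z y.
  by have := hwlog z y yz zb yb; lra.
move=> /andP[_ y1] _.
have -> : expR (- 2 * z) = expR (- 2 * y) * expR (2 * (y - z)).
  by rewrite -expRD; congr expR; ring.
have h1 : expR (- 2) <= expR (- 2 * y) by rewrite ler_expR; lra.
have h2 := expR_ge1Dx (2 * (y - z)).
have h0 := expR_gt0 (- 2 : R).
have : expR (- 2) * (2 * (y - z)) <=
    expR (- 2 * y) * (expR (2 * (y - z)) - 1).
  by apply: ler_pM; lra.
move/(ler_wpM2l (_ : 0 <= y - z)); rewrite subr_ge0 => /(_ zy).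
by lra.
Qed.

(** The tilt from [w] to [w'] is what flipping one sign does to Gibbs weights. Over a common
    denominator the difference of means is a double sum, bounded below after symmetrization: one
    factor exp (-2) comes from the increments, the other from Z' <= exp 2 * Z. The ratio multiplying
    exp (-4) is twice the variance of [y] under [w]. *)
Lemma gibbs_mean_tilt (w w' y : J -> R) (j0 : J) : (forall j, 0 < w j) ->
  (forall j, `|y j| <= 1) ->
  (forall j, w' j = w j * expR (- 2 * y j)) ->
  expR (- 4) * ((\sum_j \sum_l w j * w l * (y j - y l) ^+ 2)
                 / (\sum_j w j) ^+ 2) <=
  (\sum_j w j * y j) / (\sum_j w j) - (\sum_j w' j * y j) / (\sum_j w' j).
Proof.
move=> w_gt0 y_le1 w'E.
have sum_gt0 (v : J -> R) : (forall j, 0 < v j) -> 0 < \sum_j v j.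
  move=> v_gt0; rewrite (bigD1 j0)//= ltr_pwDl//.
  by apply: sumr_ge0 => j _; exact: ltW.
set Z := \sum_j w j; set Z' := \sum_j w' j.
set V := \sum_j \sum_l _.
have Z_gt0 : 0 < Z by exact: sum_gt0.
have Z'_gt0 : 0 < Z' by apply: sum_gt0 => j; rewrite w'E mulr_gt0 ?expR_gt0.
have Z'Z : Z' <= expR 2 * Z.
  rewrite mulr_sumr; apply: ler_sum => j _.
  rewrite w'E mulrC ler_pM2r// ler_expR.
  by have := y_le1 j; rewrite ler_norml; lra.
pose D := \sum_j \sum_l w j * w l * ((y j - y l) * expR (- 2 * y l)).
have DE : (\sum_j w j * y j) / Z - (\sum_j w' j * y j) / Z' = D / (Z * Z').
  have -> : D = (\sum_j w j * y j) * Z' - (\sum_j w' j * y j) * Z.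
    rewrite [X in _ - X]mulrC.
    rewrite !big_distrlr/= -sumrB; apply: eq_bigr => j _.
    by rewrite -sumrB; apply: eq_bigr => l _; rewrite !w'E; ring.
  by field; rewrite !gt_eqF.
have D_ge : expR (- 2) * V <= D.
  (* Adding to [D] its copy with [j] and [l] swapped produces the products bounded by
     [expR_increment_ge]. *)
  have D2 : 2 * D = \sum_j \sum_l w j * w l *
      ((y j - y l) * (expR (- 2 * y l) - expR (- 2 * y j))).
    rewrite mulr_natl mulr2n {2}/D exchange_big/= -big_split/=.
    apply: eq_bigr => j _; rewrite -big_split/=.
    by apply: eq_bigr => l _; ring.
  suff : 2 * (expR (- 2) * V) <= 2 * D by lra.
  rewrite D2 !mulr_sumr; apply: ler_sum => j _.
  rewrite !mulr_sumr; apply: ler_sum => l _.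
  have := @expR_increment_ge (y j) (y l).
  move: (y_le1 j) (y_le1 l); rewrite !ler_norml => -> -> /(_ isT isT).
  by move/(ler_wpM2l (mulr_ge0 (ltW (w_gt0 j)) (ltW (w_gt0 l)))); lra.
have V_ge0 : 0 <= V.
  apply: sumr_ge0 => j _; apply: sumr_ge0 => l _.
  by rewrite mulr_ge0 ?sqr_ge0// mulr_ge0// ltW.
have e4 : expR (- 4) = expR (- 2) * (expR 2)^-1 :> R.
  by rewrite -expRN -expRD; congr expR; lra.
rewrite DE; have -> : expR (- 4) * (V / Z ^+ 2) =
          expR (- 2) * V * (Z * (expR 2 * Z))^-1.
  by rewrite e4; field; rewrite !gt_eqF ?expR_gt0.
have le_inv : (Z * (expR 2 * Z))^-1 <= (Z * Z')^-1.
  by rewrite lef_pV2 ?posrE ?mulr_gt0 ?expR_gt0// ler_pM2l.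
apply: ler_pM => //; first by rewrite mulr_ge0 ?expR_ge0.
by rewrite invr_ge0 ?mulr_ge0 ?expR_ge0 ?ltW.
Qed.

End GibbsMeans.

(** * Random signed sums and their Gibbs measures *)

Section SignedSums.
Context {R : realType} {J : finType} {n : nat}.
Local Notation signs := {ffun 'I_n -> bool}.
Implicit Types (s : signs) (i : 'I_n) (j l : J).

Definition flip i s : signs := [ffun k => s k (+) (k == i)].

Lemma flipK i : involutive (flip i).
Proof. by move=> s; apply/ffunP => k; rewrite !ffunE addbK. Qed.

Lemma flip_id i s : flip i s i = ~~ s i.
Proof. by rewrite ffunE eqxx addbT. Qed.

Lemma sum_flip i (G : signs -> R) :
  \sum_(s : signs) G (flip i s) = \sum_(s : signs) G s.
Proof. by rewrite [RHS](reindex_inj (inv_inj (flipK i))). Qed.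

(** Pairing [s] with [flip i s] turns correlation with the i-th sign into a discrete derivative. *)
Lemma sum_sign_mul i (G : signs -> R) :
  \sum_(s : signs) (-1) ^+ s i * G s =
  2^-1 * \sum_(s : signs) (-1) ^+ s i * (G s - G (flip i s)).
Proof.
have E : \sum_(s : signs) (-1) ^+ s i * G s = - \sum_(s : signs) (-1) ^+ s i * G (flip i s).
  rewrite -(sum_flip i) -sumrN; apply: eq_bigr => s _.
  by rewrite flip_id signrN mulNr.
under [X in _ = _ * X]eq_bigr do rewrite mulrBr.
by rewrite sumrB; lra.
Qed.

Variable t : J -> 'I_n -> R.

Definition signed_sum s j : R := \sum_(i < n) (-1) ^+ s i * t j i.

Lemma signed_sum_flip i s j :
  signed_sum (flip i s) j = signed_sum s j - 2 * ((-1) ^+ s i * t j i).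
Proof.
rewrite /signed_sum (bigD1 i)//= [in RHS](bigD1 i)//= flip_id signrN.
rewrite (eq_bigr (fun k => (-1) ^+ s k * t j k)); first by ring.
by move=> k /negPf ki; rewrite ffunE ki addbF.
Qed.

Lemma sum_signed_sum j : \sum_(s : signs) signed_sum s j = 0.
Proof.
rewrite exchange_big/= big1// => i _.
by rewrite (sum_sign_mul i (fun=> t j i)) big1 ?mulr0// => s _; rewrite subrr mulr0.
Qed.

Variable lam : R.

Definition gibbs_weight s j : R := expR (lam * signed_sum s j).
Definition partition_fun s : R := \sum_j gibbs_weight s j.

Lemma gibbs_weight_gt0 s j : 0 < gibbs_weight s j.
Proof. exact: expR_gt0. Qed.

Lemma partition_fun_gt0 j s : 0 < partition_fun s.
Proof.
rewrite /partition_fun (bigD1 j)//= ltr_pwDl ?gibbs_weight_gt0//.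
by apply: sumr_ge0 => l _; exact/ltW/gibbs_weight_gt0.
Qed.

Hypothesis lam_gt0 : 0 < lam.

(* Discrete analogue of Gaussian integration by parts. *)
Lemma sum_gibbs_mean_ge (j0 : J) : (forall j i, `|lam * t j i| <= 1) ->
  lam * expR (- 4) / 2 * \sum_(s : signs) (\sum_j \sum_l
      gibbs_weight s j * gibbs_weight s l * \sum_i (t j i - t l i) ^+ 2)
    / partition_fun s ^+ 2
  <= \sum_(s : signs) (\sum_j gibbs_weight s j * signed_sum s j) / partition_fun s.
Proof.
move=> t_le1.
pose mean i s := (\sum_j gibbs_weight s j * t j i) / partition_fun s.
pose var i s := (\sum_j \sum_l
  gibbs_weight s j * gibbs_weight s l * (t j i - t l i) ^+ 2)
    / partition_fun s ^+ 2.
(* Expanding [signed_sum] splits the Gibbs mean into correlations of each sign with the mean of its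
   own coordinate. *)
have -> : \sum_(s : signs) (\sum_j gibbs_weight s j * signed_sum s j) / partition_fun s
    = \sum_i \sum_(s : signs) (-1) ^+ s i * mean i s.
  rewrite exchange_big/=; apply: eq_bigr => s _.
  rewrite /mean; under [RHS]eq_bigr do rewrite mulrA mulr_sumr.
  rewrite -mulr_suml; congr (_ / _).
  rewrite [RHS]exchange_big/=; apply: eq_bigr => j _.
  by rewrite mulr_sumr; apply: eq_bigr => i _; ring.
have -> : \sum_(s : signs) (\sum_j \sum_l
      gibbs_weight s j * gibbs_weight s l * \sum_i (t j i - t l i) ^+ 2)
    / partition_fun s ^+ 2 = \sum_i \sum_(s : signs) var i s.
  rewrite exchange_big/=; apply: eq_bigr => s _.
  rewrite /var -mulr_suml; congr (_ / _).
  rewrite [RHS]exchange_big/=; apply: eq_bigr => j _.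
  rewrite [RHS]exchange_big/=; apply: eq_bigr => l _.
  by rewrite mulr_sumr.
rewrite mulr_sumr; apply: ler_sum => i _.
rewrite sum_sign_mul !mulr_sumr; apply: ler_sum => s _.
(* Flipping sign i multiplies the weight of [j] by exp (-2 y), where y is the i-th term of lam *
   signed_sum s j. *)
have := @gibbs_mean_tilt R J (gibbs_weight s) (gibbs_weight (flip i s))
  (fun j => lam * ((-1) ^+ s i * t j i)) j0 (gibbs_weight_gt0 s).
have y_le1 j : `|lam * ((-1) ^+ s i * t j i)| <= 1.
  by rewrite mulrCA normrM normr_sign mul1r.
move=> /(_ y_le1); have w'E j : gibbs_weight (flip i s) j =
    gibbs_weight s j * expR (-2 * (lam * ((-1) ^+ s i * t j i))).
  by rewrite -expRD /gibbs_weight signed_sum_flip; congr expR; ring.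
move=> /(_ w'E).
have -> : \sum_j \sum_l gibbs_weight s j * gibbs_weight s l *
    (lam * ((-1) ^+ s i * t j i) - lam * ((-1) ^+ s i * t l i)) ^+ 2 =
    lam ^+ 2 * \sum_j \sum_l
      gibbs_weight s j * gibbs_weight s l * (t j i - t l i) ^+ 2.
  rewrite mulr_sumr; apply: eq_bigr => j _; rewrite mulr_sumr.
  apply: eq_bigr => l _.
  by have := sqrr_sign R (s i); move: ((-1) ^+ s i) => e e2; ring: e2.
have scaleE (v : J -> R) : \sum_j v j * (lam * ((-1) ^+ s i * t j i)) =
    lam * ((-1) ^+ s i * \sum_j v j * t j i).
  by rewrite !mulr_sumr; apply: eq_bigr => j _; ring.
rewrite !scaleE -/(partition_fun s) -/(partition_fun (flip i s)).
rewrite -[X in X <= _]/(expR (- 4) * (lam ^+ 2 * _ / _)) => h.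
rewrite -(ler_pM2l lam_gt0).
rewrite /var /mean; lra.
Qed.

Variable m : signs -> J.
Hypothesis m_max : forall s j, signed_sum s j <= signed_sum s (m s).

Let pmax s := gibbs_weight s (m s) / partition_fun s.

(** The maximum dominates the Gibbs mean. Separation bounds the normalised pair sum below by A *
    sum_j p_j (1 - p_j), and each 1 - p_j is at least 1 - max_j p_j. *)
Lemma sum_max_ge_separation (j0 : J) (A : R) : 0 <= A ->
  (forall j i, `|lam * t j i| <= 1) ->
  (forall j l, j != l -> A <= \sum_i (t j i - t l i) ^+ 2) ->
  lam * expR (- 4) / 2 * A * \sum_(s : signs) (1 - pmax s) <=
  \sum_(s : signs) signed_sum s (m s).
Proof.
move=> A_ge0 t_le1 sepA.
have w_ge0 s j : 0 <= gibbs_weight s j by exact/ltW/gibbs_weight_gt0.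
have le_mean : \sum_(s : signs) (\sum_j gibbs_weight s j * signed_sum s j)
    / partition_fun s <= \sum_(s : signs) signed_sum s (m s).
  apply: ler_sum => s _; rewrite ler_pdivrMr ?partition_fun_gt0//.
  rewrite mulr_sumr; apply: ler_sum => j _.
  by rewrite mulrC ler_wpM2r.
apply: le_trans le_mean; apply: le_trans (sum_gibbs_mean_ge j0 t_le1).
rewrite -mulrA ler_wpM2l//.
  by rewrite divr_ge0// mulr_ge0 ?expR_ge0// ltW.
rewrite mulr_sumr; apply: ler_sum => s _.
have Z_gt0 := partition_fun_gt0 j0 s.
rewrite ler_pdivlMr ?exprn_gt0//.
have -> : A * (1 - pmax s) * partition_fun s ^+ 2 =
    \sum_j gibbs_weight s j * (A * (partition_fun s - gibbs_weight s (m s))).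
  by rewrite -mulr_suml -/(partition_fun s) /pmax; field; rewrite gt_eqF.
apply: ler_sum => j _.
under eq_bigr do rewrite -mulrA; rewrite -mulr_sumr ler_wpM2l//.
rewrite (bigD1 j)//= (le_trans _ (ler_wpDl _ (lexx _)))//.
  have : A * \sum_(l | l != j) gibbs_weight s l <= \sum_(l | l != j)
      gibbs_weight s l * \sum_i (t j i - t l i) ^+ 2.
    rewrite mulr_sumr; apply: ler_sum => l lj.
    by rewrite mulrC ler_wpM2l// sepA// eq_sym.
  apply: le_trans; rewrite ler_wpM2l//.
  rewrite /partition_fun (bigD1 j)//= lerBlDl lerD2r.
  by rewrite ler_expR ler_pM2l.
by rewrite mulr_ge0// sumr_ge0// => i _; exact: sqr_ge0.
Qed.

(* -ln pmax lies in [0, ln #|J|], and its mean is large by Jensen's inequality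
   for the partition function. *)
Lemma sum_one_sub_pmax_ge : (1 < #|J|)%N ->
  2 ^+ n * ln #|J|%:R - lam * \sum_(s : signs) signed_sum s (m s) <=
  3 * ln #|J|%:R * \sum_(s : signs) (1 - pmax s).
Proof.
move=> J_gt1; set L : R := ln _.
have J_gt0 : 0 < #|J|%:R :> R by rewrite ltr0n ltnW.
have [j0 _] : exists j : J, j \in J by apply/card_gt0P; exact: ltnW.
(* At the end this turns 1 + x <= 1 + L into 1 + x <= 3 L, whence the factor 3. *)
have L_ge : 2^-1 <= L.
  rewrite -ler_expR lnK ?posrE//.
  have h := expR_ge1Dx (- 2^-1 : R).
  have : expR (2^-1 : R) * expR (- 2^-1) = 1 by rewrite -expRD subrr expR0.
  have : (2 : R) <= #|J|%:R by rewrite ler_nat.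
  have := expR_gt0 (2^-1 : R).
  by nra.
pose mean s := #|J|%:R^-1 * \sum_j lam * signed_sum s j.
have sum_mean : \sum_(s : signs) mean s = 0.
  rewrite -mulr_sumr exchange_big/= big1 ?mulr0// => j _.
  by rewrite -mulr_sumr sum_signed_sum mulr0.
have -> : 2 ^+ n * L - lam * \sum_(s : signs) signed_sum s (m s) =
    \sum_(s : signs) (L + mean s - lam * signed_sum s (m s)).
  rewrite sumrB big_split/= sum_mean addr0 mulr_sumr.
  by rewrite sumr_const card_ffun card_bool card_ord -[RHS]/(_ - _) -natrX mulr_natl.
rewrite mulr_sumr; apply: ler_sum => s _.
have Z_gt0 := partition_fun_gt0 j0 s.
pose x := ln (partition_fun s) - lam * signed_sum s (m s).
have pmaxE : pmax s = expR (- x).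
  by rewrite opprB expRD expRN lnK ?posrE.
(* Jensen's inequality: each weight lies above the tangent line of exp at [mean s], and the linear
   terms cancel in the sum. *)
have x_ge : L + mean s - lam * signed_sum s (m s) <= x.
  rewrite lerD2r -ler_expR lnK ?posrE// expRD lnK ?posrE//.
  have -> : #|J|%:R * expR (mean s) =
      \sum_j expR (mean s) * (1 + (lam * signed_sum s j - mean s)).
    rewrite -mulr_sumr big_split/= sumrB !sumr_const -mulr_natl mulr1.
    rewrite -[\sum_(i in J) _]/(\sum_i _) -[mean s *+ _]mulr_natl /mean.
    by field; rewrite gt_eqF.
  apply: ler_sum => j _.
  have -> : gibbs_weight s j =
      expR (mean s) * expR (lam * signed_sum s j - mean s).
    by rewrite -expRD; congr expR; ring.
  by rewrite ler_wpM2l ?expR_ge0// expR_ge1Dx.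
have x_ge0 : 0 <= x.
  rewrite subr_ge0 -ler_expR lnK ?posrE// /partition_fun (bigD1 (m s))//=.
  by rewrite lerDl sumr_ge0// => j _; exact/ltW/gibbs_weight_gt0.
have x_leL : x <= L.
  rewrite lerBlDr -ler_expR lnK ?posrE// expRD lnK ?posrE//.
  rewrite mulr_natl -sumr_const; apply: ler_sum => j _.
  by rewrite ler_expR ler_pM2l.
apply: le_trans x_ge _; rewrite pmaxE.
(* Rearranged, this bounds x = - ln pmax by (1 + x) (1 - pmax). *)
have h1 : (1 + x) * expR (- x) <= 1.
  by rewrite -[leRHS](@expRxMexpNx_1 R x) ler_wpM2r ?expR_ge0 ?expR_ge1Dx.
have h0 := expR_gt0 (- x).
have h2 : x <= (1 + x) * (1 - expR (- x)) by lra.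
apply: le_trans h2 _; apply: ler_wpM2r; last by lra.
by rewrite subr_ge0 expR_le1; lra.
Qed.

End SignedSums.

(** * Sudakov minoration for a finite Bernoulli process *)

Section SudakovMinoration.
Context {R : realType} {J : finType} {n : nat}.
Local Notation signs := {ffun 'I_n -> bool}.
Variables (t : J -> 'I_n -> R) (m : signs -> J).
Hypothesis m_max : forall s j, signed_sum t s j <= signed_sum t s (m s).

Lemma sum_max_signed_sum_ge (A b : R) : 0 < A -> 0 < b ->
  (forall j i, `|t j i| <= b) ->
  (forall j l, j != l -> A <= \sum_i (t j i - t l i) ^+ 2) ->
  expR (- 4) / 12 * Num.min (Num.sqrt (A * ln #|J|%:R)) (A / b) * 2 ^+ n <=
  \sum_(s : signs) signed_sum t s (m s).
Proof.
move=> A_gt0 b_gt0 t_le sepA; set M := \sum_(s : signs) _.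
have M_ge0 : 0 <= M.
  rewrite -(sum_signed_sum t (m [ffun=> false])).
  exact: ler_sum.
(* With at most one point the logarithm is at most 0, so the square root and hence the lower bound
   are trivial. *)
have [J_gt1|J_le1] := ltnP 1 #|J|; last first.
  apply: le_trans M_ge0; rewrite pmulr_lle0 ?exprn_gt0//.
  rewrite pmulr_rle0 ?divr_gt0 ?expR_gt0// ge_min.
  suff /ler0_sqrtr -> : A * ln #|J|%:R <= 0 by rewrite lexx.
  by rewrite pmulr_rle0// ln_le0// lern1.
have [j0 _] : exists j : J, j \in J by apply/card_gt0P; exact: ltnW.
set L : R := ln _.
have L_gt0 : 0 < L by rewrite ln_gt0// ltr1n.
set q := Num.min _ _.
pose r := Num.sqrt (A * L).
have r_gt0 : 0 < r by rewrite sqrtr_gt0 mulr_gt0.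
have r2 : r ^+ 2 = A * L by rewrite sqr_sqrtr// mulr_ge0// ltW.
have q_gt0 : 0 < q by rewrite lt_min r_gt0 divr_gt0.
have q_ler : q <= r by rewrite ge_min lexx.
have q_leb : q <= A / b by rewrite ge_min lexx orbT.
(* This is min (sqrt (L / A)) (1 / b): it gives both lam * b <= 1 and lam * A = q. *)
pose lam := q / A.
have lam_gt0 : 0 < lam by rewrite divr_gt0.
have lamA : lam * A = q by rewrite divfK// gt_eqF.
have lam_t j i : `|lam * t j i| <= 1.
  rewrite normrM gtr0_norm// (le_trans (ler_wpM2l (ltW lam_gt0) (t_le j i)))//.
  by rewrite mulrAC ler_pdivrMr// mul1r -ler_pdivlMr.
have sep := sum_max_ge_separation lam_gt0 m_max j0 (ltW A_gt0) lam_t sepA.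
have ent := sum_one_sub_pmax_ge lam_gt0 m_max J_gt1.
rewrite -/L -/M in sep ent.
set E := \sum_(s : signs) _ in sep ent.
have K_gt0 : 0 < 2 ^+ n :> R by rewrite exprn_gt0.
set K := 2 ^+ n in K_gt0 ent *.
have e_gt0 := expR_gt0 (- 4 : R).
have e_le1 : expR (- 4) <= 1 :> R by rewrite expR_le1; lra.
have sep' : q * expR (- 4) / 2 * E <= M.
  by move: sep; rewrite -lamA; congr (_ <= _); ring.
(* If lam M is small, [ent] yields K <= 6 E, and [sep'] then gives the constant exp (-4) / 12.
   Otherwise q ^ 2 K <= A L K <= 2 q M gives the larger bound q K / 2. *)
have [lamM|lamM] := leP (lam * M) (L / 2 * K).
  have : K <= 6 * E.
    suff : L * K <= L * (6 * E) by rewrite ler_pM2l.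
    lra.
  have qe : 0 <= q * expR (- 4) / 2 by rewrite divr_ge0// mulr_ge0 ?expR_ge0// ltW.
  by move/(ler_wpM2l qe); lra.
have : q * (q * K) <= q * (2 * M).
  have : A * (L / 2 * K) <= A * (lam * M) by rewrite ler_pM2l// ltW.
  have : q ^+ 2 * K <= A * L * K.
    by rewrite -r2 ler_pM2r// ler_pXn2r// nnegrE ltW.
  by rewrite [A * (lam * M)]mulrA [A * lam]mulrC lamA; lra.
rewrite ler_pM2l// => qK.
have : expR (- 4) * (q * K) <= 1 * (q * K).
  by rewrite ler_wpM2r// mulr_ge0// ltW.
lra.
Qed.

End SudakovMinoration.

(** For each sign vector, the supremum over [G] dominates the value at a maximiser in the finite
    family [g]. *)
Lemma rademacher_ge (R : realType) (n : nat) (X : Type) (S : 'I_n -> X)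
    (G : set (X -> R)) (J : finType) (g : J -> X -> R) (A b : R) :
  (0 < #|J|)%N -> 0 < A -> 0 < b -> (forall j, G (g j)) ->
  (forall j i, `|g j (S i)| <= b) ->
  (forall j l, j != l -> A <= \sum_i (g j (S i) - g l (S i)) ^+ 2) ->
  ((n%:R^-1 * (expR (- 4) / 12 *
     Num.min (Num.sqrt (A * ln #|J|%:R)) (A / b)))%:E <= rademacher S G)%E.
Proof.
move=> /card_gt0P[j0 _] A_gt0 b_gt0 Gg g_le sepA.
pose t j i := g j (S i).
pose m (s : {ffun 'I_n -> bool}) := [arg max_(j > j0) signed_sum t s j]%O.
have m_max s j : signed_sum t s j <= signed_sum t s (m s).
  by rewrite /m; case: arg_maxP => // k _; apply.
have := sum_max_signed_sum_ge m_max A_gt0 b_gt0 g_le sepA.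
rewrite -ler_pdivlMr ?exprn_gt0// => h.
apply: (@le_trans _ _ (((2 ^+ n)^-1)%:E *
    \sum_(s : {ffun 'I_n -> bool}) (n%:R^-1 * signed_sum t s (m s))%:E)%E).
  rewrite sumEFin -EFinM lee_fin -mulr_sumr [leRHS]mulrCA.
  by rewrite ler_wpM2l ?invr_ge0// [leRHS]mulrC.
rewrite lee_wpmul2l ?lee_fin ?invr_ge0 ?exprn_ge0//.
apply: lee_sum => s _; apply: ereal_sup_ubound.
by exists (g (m s)).
Qed.

(** * Packing and covering numbers through finite packings *)

Section PackingCoveringNumbers.
Context {R : realType} {T : choiceType}.
Variables (A : set T) (rho : T -> T -> R) (eps : R).
Local Open Scope ereal_scope.

Definition packing (P : set T) : Prop :=
  P `<=` A /\ forall x y, P x -> P y -> x <> y -> (eps <= rho x y)%R.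

Lemma packing_sub (P Q : set T) : Q `<=` P -> packing P -> packing Q.
Proof.
move=> QP [PA Psep]; split=> [x /QP /PA//|x y /QP Px /QP Py]; exact: Psep.
Qed.

Lemma counting_fset (B : {fset T}) : counting [set` B] = #|` B|%:R%:E :> \bar R.
Proof.
rewrite /counting; case: asboolP => [_|/(_ (finite_fset B))//].
by rewrite set_fsetK.
Qed.

Lemma packing_number_ge_fset (B : {fset T}) :
  packing [set` B] -> #|` B|%:R%:E <= packing_number A rho eps.
Proof.
by move=> packB; apply: ereal_sup_ubound; exists [set` B] => //; exact: counting_fset.
Qed.

(** An infinite packing contains finite ones of every size, so finite packings decide the supremum:
    their sizes are unbounded, or a largest one attains it. *)
Lemma packing_number_fset :
  (packing_number A rho eps = +oo /\
     forall N, exists2 B : {fset T}, packing [set` B] & (N <= #|` B|)%N) \/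
  (exists B : {fset T}, [/\ packing [set` B],
     packing_number A rho eps = #|` B|%:R%:E &
     forall B' : {fset T}, packing [set` B'] -> (#|` B'| <= #|` B|)%N]).
Proof.
pose sz N := `[< exists2 B : {fset T}, packing [set` B] & #|` B| = N >].
have [unbdd|] := pselect
    (forall N, exists2 B : {fset T}, packing [set` B] & (N <= #|` B|)%N).
  left; split=> //; apply/eqyP => r r_gt0.
  have [B packB leB] := unbdd (Num.truncn r).+1.
  apply: le_trans (packing_number_ge_fset packB).
  by rewrite lee_fin (le_trans (ltW (truncnS_gt r)))// ler_nat.
move=> /existsNP[N0 bdd]; right.
have ub (B : {fset T}) : packing [set` B] -> (#|` B| <= N0)%N.
  by move=> packB; rewrite leqNgt; apply/negP => /ltnW ltB; apply: bdd; exists B.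
have sz0 : exists N, sz N.
  exists 0%N; apply/asboolP; exists fset0%fset; last exact: cardfs0.
  by split=> [x|x y]; rewrite /= in_fset0.
have szub N : sz N -> (N <= N0)%N by move=> /asboolP[B packB <-]; exact: ub.
case: (ex_maxnP sz0 szub) => N /asboolP[B packB BN] maxN.
have maxB (B' : {fset T}) : packing [set` B'] -> (#|` B'| <= #|` B|)%N.
  by move=> packB'; rewrite BN; apply: maxN; apply/asboolP; exists B'.
exists B; split=> //; apply/eqP; rewrite eq_le packing_number_ge_fset// andbT.
apply: ge_ereal_sup => _ [P packP <-].
have [finP|infP] := pselect (finite_set P).
  rewrite -(fset_setK finP) counting_fset lee_fin ler_nat maxB//.
  by rewrite fset_setK.
have [C CP leC] := infinite_set_fset N0.+1 infP.
by have := ub _ (packing_sub CP packP); rewrite leqNgt leC.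
Qed.

Lemma packing_number_ge1 : A !=set0 -> 1 <= packing_number A rho eps.
Proof.
move=> [x Ax]; have := @packing_number_ge_fset [fset x]%fset.
rewrite cardfs1; apply; split=> [y|y z]; rewrite /= !in_fset1.
  by move=> /eqP ->.
by move=> /eqP -> /eqP ->.
Qed.

Lemma covering_number_ge0 : 0 <= covering_number A rho eps.
Proof.
apply: le_ereal_inf_tmp => _ [P _ <-].
by rewrite /counting; case: ifP => _; rewrite ?leey ?lee_fin.
Qed.

(** A point left uncovered by a largest packing could be adjoined to it, contradicting
    maximality. *)
Lemma covering_le_packing_number : (0 < eps)%R ->
  (forall x, rho x x = 0%R) -> (forall x y, rho x y = rho y x) ->
  covering_number A rho eps <= packing_number A rho eps.
Proof.
move=> eps_gt0 rhoxx rhoC.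
have [[-> _]|[B [packB -> maxB]]] := packing_number_fset; first exact: leey.
apply: ereal_inf_lbound; exists [set` B]; last exact: counting_fset.
have [BA Bsep] := packB; split=> // y Ay; apply: contrapT => /= farB.
have sep x : x \in B -> (eps <= rho x y)%R.
  by move=> xB; rewrite leNgt; apply/negP => xy; apply: farB; exists x.
have yB : y \notin B.
  by apply/negP => /sep; rewrite rhoxx leNgt eps_gt0.
have : packing [set` (y |` B)%fset].
  split=> [x|x z]; rewrite /= !in_fset1U.
    by case/predU1P => [->//|/BA].
  case/predU1P => [->|xB]; case/predU1P => [->|zB]//.
  - by move=> _; rewrite rhoC sep.
  - by move=> _; rewrite sep.
  - exact: Bsep.
by move/maxB; rewrite cardfsU1 yB ltnn.
Qed.

End PackingCoveringNumbers.

(** * From packings of self-maps to the Rademacher complexity *)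

Section SampleRadius.
Context {R : realType} {X : metricType R} {n : nat}.
Variable S : 'I_n -> X.

Lemma dist_samplexx f : dist_sample S f f = 0.
Proof.
by rewrite /dist_sample big1 ?mulr0 ?sqrtr0// => i _; rewrite mdistxx expr0n.
Qed.

Lemma dist_sampleC f g : dist_sample S f g = dist_sample S g f.
Proof.
by congr (Num.sqrt (_ * _)); apply: eq_bigr => i _; rewrite metric_sym.
Qed.

(** [Psi] carries a packing to a separated family bounded by [Rout] on the sample. Scale 2 eps
    yields surplus factors 2 and 4 in the two terms of the minimum, which are discarded. *)
Lemma rademacher_ge_packing (G : set (X -> R)) (A : set (X -> X))
    (Psi : (X -> X) -> (X -> R)) (kappa Rout eps : R) (B : {fset (X -> X)}) :
  (0 < n)%N -> 0 < kappa -> 0 < Rout -> 0 < eps ->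
  (forall f, A f -> G (Psi f)) ->
  (forall f g, A f -> A g ->
     kappa * dist_sample S f g <= norm2_sample S (Psi f \- Psi g)) ->
  (forall f, A f -> normsup_sample S (Psi f) <= Rout) ->
  packing A (dist_sample S) (2 * eps) [set` B] -> (0 < #|` B|)%N ->
  ((expR (- 4) / 12 * Num.min (kappa * eps * Num.sqrt (ln #|` B|%:R / n%:R))
     (kappa ^+ 2 * eps ^+ 2 / Rout))%:E <= rademacher S G)%E.
Proof.
move=> n_gt0 kappa_gt0 Rout_gt0 eps_gt0 GPsi kappaP RoutP [BA Bsep] B_gt0.
have nR_gt0 : 0 < n%:R :> R by rewrite ltr0n.
(* The factor n undoes the 1 / n normalisation in [norm2_sample]. *)
pose A2 := n%:R * (kappa * (2 * eps)) ^+ 2.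
have A2_gt0 : 0 < A2 by rewrite mulr_gt0// exprn_gt0// !mulr_gt0.
have B_gt0' : (0 < #|{: B}|)%N by rewrite -cardfE.
have Psi_le (j : B) i : `|Psi (val j) (S i)| <= Rout.
  exact: le_trans (le_bigmax _ _ i) (RoutP _ (BA _ (valP j))).
have Psi_sep (j l : B) : j != l ->
    A2 <= \sum_i (Psi (val j) (S i) - Psi (val l) (S i)) ^+ 2.
  move=> jl; have jl' : val j <> val l by move/val_inj/eqP; rewrite (negPf jl).
  have := kappaP _ _ (BA _ (valP j)) (BA _ (valP l)).
  have := Bsep _ _ (valP j) (valP l) jl'.
  move/(ler_wpM2l (ltW kappa_gt0)) => h /(le_trans h) sep.
  have : (kappa * (2 * eps)) ^+ 2 <=
      norm2_sample S (Psi (val j) \- Psi (val l)) ^+ 2.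
    rewrite ler_sqr ?nnegrE ?sqrtr_ge0//.
    by rewrite !mulr_ge0// ltW.
  rewrite /norm2_sample.
  have sum_ge0 : 0 <= \sum_i `|(Psi (val j) \- Psi (val l)) (S i)| ^+ 2.
    by apply: sumr_ge0 => i _; exact: sqr_ge0.
  rewrite sqr_sqrtr ?mulr_ge0 ?invr_ge0// ler_pdivlMl//.
  move=> /le_trans; apply.
  by apply: ler_sum => i _; rewrite real_normK ?num_real.
have := @rademacher_ge R n X S G B (fun j => Psi (val j)) A2 Rout B_gt0'
  A2_gt0 Rout_gt0 (fun j => GPsi _ (BA _ (valP j))) Psi_le Psi_sep.
apply: le_trans; rewrite lee_fin [leRHS]mulrCA ler_pM2l ?divr_gt0 ?expR_gt0//.
rewrite -cardfE; set L := ln _.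
have L_ge0 : 0 <= L by rewrite ln_ge0// ler1n.
rewrite [leRHS]mulrC minr_pMl ?invr_ge0// le_min; apply/andP; split.
  rewrite ge_min; apply/orP; left.
  have -> : A2 * L = (kappa * (2 * eps) * n%:R) ^+ 2 * (L / n%:R).
    by rewrite /A2; field; rewrite gt_eqF.
  have pos : 0 <= kappa * (2 * eps) * n%:R by rewrite !mulr_ge0// ltW.
  rewrite [in leRHS]sqrtrM ?sqr_ge0// sqrtr_sqr ger0_norm//.
  have -> : kappa * (2 * eps) * n%:R * Num.sqrt (L / n%:R) / n%:R =
      2 * (kappa * eps * Num.sqrt (L / n%:R)) by field; rewrite gt_eqF.
  have : 0 <= kappa * eps * Num.sqrt (L / n%:R).
    by rewrite !mulr_ge0 ?sqrtr_ge0// ltW.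
  lra.
rewrite ge_min; apply/orP; right.
have -> : A2 / Rout / n%:R = 4 * (kappa ^+ 2 * eps ^+ 2 / Rout).
  by rewrite /A2; field; rewrite !gt_eqF.
have : 0 <= kappa ^+ 2 * eps ^+ 2 / Rout.
  by rewrite !mulr_ge0 ?exprn_ge0 ?invr_ge0// ltW.
lra.
Qed.

End SampleRadius.

(** * The lower bound for compositions, in packing and covering form *)

Theorem theorem3 (R : realType) :
  exists c c' a : R, [/\ 0 < c, 0 < c', 0 < a &
  forall (X : metricType R) (F : set (X -> X)) (H : set (X -> R))
    (k n : nat) (S : 'I_n -> X) (kappa Rout : R)
    (h : (X -> X) -> (X -> R)),
  let B := compositions k F in
  let Hk := comp_class H B in
  let Psi := fun f : X -> X => h f \o f in
  (0 < n)%N ->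
  (forall f, F f -> continuous f) ->
  (forall u, H u -> continuous u) ->
  0 < kappa -> 0 < Rout ->
  (forall f, B f -> H (h f)) ->
  (forall f g, B f -> B g ->
     kappa * dist_sample S f g <= norm2_sample S (Psi f \- Psi g)) ->
  (forall f, B f -> normsup_sample S (Psi f) <= Rout) ->
  (c%:E * ereal_sup
     [set mine ((kappa * eps)%:E *
                sqrte (lne (packing_number B (dist_sample S) (2 * eps))
                       * (n%:R^-1)%:E))
               (kappa ^+ 2 * eps ^+ 2 / Rout)%:E
     | eps in [set eps : R | (0 < eps)%R]]
   <= rademacher S Hk)%E
  /\
  (c'%:E * ereal_sup
     [set mine ((kappa * eps)%:E *
                sqrte (lne (covering_number B (dist_sample S) (a * eps))
                       * (n%:R^-1)%:E))
               (kappa ^+ 2 * eps ^+ 2 / Rout)%:E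
     | eps in [set eps : R | (0 < eps)%R]]
   <= rademacher S Hk)%E].
Proof.
exists (expR (- 4) / 12), (expR (- 4) / 12), 2.
have c_gt0 : 0 < expR (- 4) / 12 :> R by rewrite divr_gt0 ?expR_gt0.
split=> // X F H k n S kappa Rout h B Hk Psi n_gt0 _ _ kappa_gt0 Rout_gt0.
move=> Hh kappaP RoutP.
(* The identity is the empty composition; hence packing numbers are at least 1 and their logarithms
   non-negative. *)
have B0 : B !=set0 by exists idfun, [::]; split.
have Hk_Psi f : B f -> Hk (Psi f) by move=> Bf; exists (h f), f; split=> //; exact: Hh.
pose term (M : \bar R) (eps : R) := mine
  ((kappa * eps)%:E * sqrte (lne M * (n%:R^-1)%:E))%E
  (kappa ^+ 2 * eps ^+ 2 / Rout)%:E.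
pose M eps := packing_number B (dist_sample S) (2 * eps).
have M_ge1 eps : (1 <= M eps)%E by exact: packing_number_ge1.
have packing_term eps : 0 < eps ->
    ((expR (- 4) / 12)%:E * term (M eps) eps <= rademacher S Hk)%E.
  move=> eps_gt0.
  have lower (P : {fset (X -> X)}) := @rademacher_ge_packing R X n S Hk B Psi
    kappa Rout eps P n_gt0 kappa_gt0 Rout_gt0 eps_gt0 Hk_Psi kappaP RoutP.
  rewrite /term /M; have M1 := M_ge1 eps; rewrite /M in M1.
  have [[ME unbdd]|[P [packP ME _]]] := packing_number_fset B (dist_sample S) (2 * eps).
    rewrite ME /= mulyr gtr0_sg ?invr_gt0 ?ltr0n// mul1e /=.
    rewrite mulry gtr0_sg ?mulr_gt0// mul1e min_r ?leey//.
    set Q := kappa ^+ 2 * eps ^+ 2 / Rout.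
    (* For an infinite packing number the minimum equals [Q]. A finite packing with ln #|P| >= v
       already makes the entropy term at least [Q]. *)
    pose v := n%:R * (Q / (kappa * eps)) ^+ 2.
    have [P packP leP] := unbdd (Num.truncn (expR v)).+1.
    have P_gt0 : (0 < #|` P|)%N by exact: leq_trans leP.
    apply: le_trans (lower P packP P_gt0).
    rewrite -EFinM lee_fin ler_pM2l// le_min lexx andbT.
    have Q_ge0 : 0 <= Q by rewrite !mulr_ge0 ?exprn_ge0 ?invr_ge0// ltW.
    rewrite mulrC -ler_pdivrMr ?mulr_gt0//.
    have ratio_ge0 : 0 <= Q / (kappa * eps) by rewrite divr_ge0// mulr_ge0// ltW.
    rewrite -(ger0_norm ratio_ge0) -sqrtr_sqr.
    apply: ler_wsqrtr; rewrite ler_pdivlMr ?ltr0n// mulrC -/v.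
    rewrite -ler_expR lnK ?posrE ?ltr0n//.
    by rewrite (le_trans (ltW (truncnS_gt _)))// ler_nat.
  have P_gt0 : (0 < #|` P|)%N by move: M1; rewrite ME lee_fin ler1n.
  rewrite ME lne_EFin ?ltr0n//= -!EFin_min -EFinM.
  exact: lower.
have term_le (M1 M2 : \bar R) eps : 0 < eps -> (0 <= M1)%E -> (1 <= M2)%E ->
    (M1 <= M2)%E -> (term M1 eps <= term M2 eps)%E.
  move=> eps_gt0 M1_ge0 M2_ge1 M12.
  have M2_ge0 : (0 <= M2)%E by exact: le_trans M2_ge1.
  rewrite /term le_min !ge_min lexx orbT andbT; apply/orP; left.
  rewrite lee_wpmul2l ?lee_fin ?(ltW (mulr_gt0 kappa_gt0 eps_gt0))//.
  (* [M2_ge1] makes the larger radicand non-negative, as comparing square roots requires. *)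
  rewrite lee_sqrt ?mule_ge0 ?lne_ge0 ?lee_fin ?invr_ge0//.
  rewrite lee_wpmul2r ?lee_fin ?invr_ge0//.
  by rewrite lee_lne ?in_itv/= ?M1_ge0 ?M2_ge0 ?leey.
(* Serves both claims: [N] is the packing number itself or the covering number at the same scale 2
   eps. *)
have c_sup (N : R -> \bar R) : (forall eps, 0 < eps -> (0 <= N eps <= M eps)%E) ->
    ((expR (- 4) / 12)%:E * ereal_sup [set term (N eps) eps | eps in
       [set eps : R | (0 < eps)%R]] <= rademacher S Hk)%E.
  move=> NM; rewrite -lee_pdivlMl//; apply: ge_ereal_sup => _ [eps eps_gt0 <-].
  rewrite lee_pdivlMl//; apply: le_trans (packing_term _ eps_gt0).
  have /andP[N_ge0 leNM] := NM _ eps_gt0.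
  by rewrite lee_wpmul2l ?lee_fin ?(ltW c_gt0)// term_le.
split; apply: c_sup => eps eps_gt0.
  by rewrite lexx andbT (le_trans _ (M_ge1 eps)).
rewrite covering_number_ge0 covering_le_packing_number ?mulr_gt0//.
- exact: dist_samplexx.
- exact: dist_sampleC.
Qed.
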